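(* Consider the leader system $v(t+1)=Sv(t)$, $v(t)\in\mathbb R^q$, $S\in\mathbb R^{q\times q}$, and, for $i=1,\dots,N$, $$S_i(t+1)=S_i(t)+\mu_1\sum_{j=0}^Na_{ij}(S_j(t)-S_i(t)),$$ $$\eta_i(t+1)=S_i(t)\eta_i(t)+\mu_2S_i(t)\sum_{j=0}^Na_{ij}(\eta_j(t)-\eta_i(t)),$$ where $S_0(t)=S$, $\eta_0(t)=v(t)$, $S_i(t)\in\mathbb R^{q\times q}$, $\eta_i(t)\in\mathbb R^q$, $\mu_1,\mu_2>0$, and $[a_{ij}]_{i,j=0}^N$ is the weighted adjacency matrix of the directed graph $\bar{\mathcal G}$. Let $\tilde S_i=S_i-S$ and $\tilde\eta_i=\eta_i-v$. Then, for any initial values $S_i(0)$ and $\eta_i(0)$, $i=1,\dots,N$ (and any $v(0)$): (i) If $\bar{\mathcal G}$ contains a spanning tree with node $0$ as the root, then for any $\mu_1$ satisfying $0<\mu_1<\frac{2}{\rho(H)}$, and for $i=1,\dots,N$, $\lim_{t\to\infty}\tilde S_i(t)=0$ exponentially. (ii) If all eigenvalues of $S$ have modulus smaller than or equal to $1$, $\bar{\mathcal G}$ contains a spanning tree with node $0$ as the root, $\mu_1$ satisfies $0<\mu_1<\frac{2}{\rho(H)}$, and $\mu_2$ is such that the matrix $(I_N\otimes S)-\mu_2(H\otimes S)$ is Schur, then for $i=1,\dots,N$, $\lim_{t\to\infty}\tilde\eta_i(t)=0$ exponentially.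
   Context: Time $t$ ranges over the nonnegative integers. A square matrix is Schur if all its eigenvalues have modulus less than $1$. For a square matrix $A$ with spectrum $\sigma(A)$, $\rho(A)=\max_{\lambda\in\sigma(A)}\frac{|\lambda|^2}{\mathrm{Re}(\lambda)}$ (this is not the spectral radius in general). $\otimes$ is the Kronecker product. Convergence of $y(t)$ to $0$ is exponential if $\|y(t)\|\le c\,\alpha^t$ for all $t\ge0$ for some $c>0$, $0<\alpha<1$ (the constants may depend on the trajectory). $\bar{\mathcal G}=(\bar{\mathcal V},\bar{\mathcal E})$ is a directed graph with $\bar{\mathcal V}=\{0,1,\dots,N\}$ (node $0$ is the leader, nodes $1,\dots,N$ the followers). Its weighted adjacency matrix satisfies $a_{ii}=0$, $a_{ij}>0$ if $(j,i)\in\bar{\mathcal E}$, and $a_{ij}=0$ otherwise. A spanning tree rooted at $0$ means that every other node is reachable from $0$ by a directed path. $H=[h_{ij}]\in\mathbb R^{N\times N}$ ($i,j=1,\dots,N$) with $h_{ii}=\sum_{j=0}^Na_{ij}$ and $h_{ij}=-a_{ij}$ for $i\ne j$. *)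

(* Defs.v *)
(* MathComp and MathComp-Analysis: the reals are an arbitrary [R : realType],
   the complex numbers are [R[i]]. *)
From HB Require Import structures.
From mathcomp Require Import all_boot all_order all_algebra.
From mathcomp Require Import all_classical all_reals all_analysis.
From mathcomp.real_closed Require Export complex mxtens.

Set Implicit Arguments.
Unset Strict Implicit.
Unset Printing Implicit Defensive.

Import Order.TTheory GRing.Theory Num.Theory.
Import numFieldNormedType.Exports.

Local Open Scope classical_set_scope.
Local Open Scope complex_scope.
Local Open Scope ring_scope.

Definition spectrum (R : realType) (n : nat) (A : 'M[R]_n) : set R[i] :=
  [set z : R[i] | eigenvalue (map_mx (real_complex R) A) z].

Definition schur (R : realType) (n : nat) (A : 'M[R]_n) : Prop :=
  forall z, spectrum A z -> Normc.normc z < 1.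

(* The supremum is a maximum as soon as n > 0, see [rho_max] below. A quotient
   with a zero denominator is 0; this is harmless when the spectrum lies in the
   open right half-plane. *)
Definition rho (R : realType) (n : nat) (A : 'M[R]_n) : R :=
  sup [set Normc.normc z ^+ 2 / complex.Re z | z in spectrum A].

(* [E j i] is the edge (j, i), from j to i, and [a i j] is its weight. Since the
   diagonal of [a] is zero, this forces [E] to be irreflexive. *)
Definition weighted_adjacency (R : realType) (n : nat) (E : rel 'I_n)
    (a : 'M[R]_n) : Prop :=
  [/\ forall i, a i i = 0,
      forall i j, E j i -> 0 < a i j
    & forall i j, ~~ E j i -> a i j = 0].

Definition spanning_tree_rooted_at (T : finType) (E : rel T) (r : T) : Prop :=
  forall i, i != r -> connect E r i.

(* Node 0 is the leader [ord0]; for i : 'I_N, [follower i] is the node i + 1. *)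
Definition follower (N : nat) (i : 'I_N) : 'I_N.+1 := lift ord0 i.

Definition Hmx (R : realType) (N : nat) (a : 'M[R]_N.+1) : 'M[R]_N :=
  \matrix_(i, j) (if i == j then \sum_(k < N.+1) a (follower i) k
                  else - a (follower i) (follower j)).

(* On matrices and column vectors [`| _ |] is the entrywise maximum norm; all
   norms on these finite-dimensional spaces define the same notion. *)
Definition exp_cvg0 (R : realType) (V : normedModType R) (y : nat -> V) : Prop :=
  (y @ \oo --> (0 : V)) /\
  exists c alpha : R, [/\ 0 < c, 0 < alpha, alpha < 1
                        & forall t, `|y t| <= c * alpha ^+ t].

Lemma rho_max (R : realType) (n : nat) (A : 'M[R]_n) : (0 < n)%N ->
  (exists2 z, spectrum A z & rho A = Normc.normc z ^+ 2 / complex.Re z) /\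
  (forall z, spectrum A z -> Normc.normc z ^+ 2 / complex.Re z <= rho A).
Proof.
move=> n0; pose f (z : R[i]) := Normc.normc z ^+ 2 / complex.Re z.
pose p := char_poly (map_mx (real_complex R) A).
have p0 : p != 0 by exact/monic_neq0/char_poly_monic.
have [rs prs] := closed_field_poly_normal p.
have specE z : spectrum A z <-> z \in rs.
  rewrite /spectrum /= eigenvalue_root_char -/p prs rootZ ?lead_coef_eq0 //.
  by rewrite root_prod_XsubC.
have [z0 z0rs] : exists z, z \in rs.
  have /closed_rootP[z] : size p != 1 by rewrite size_char_poly eqSS -lt0n.
  by rewrite -eigenvalue_root_char => /specE; exists z.
have [m mrs mmax] : exists2 m, m \in rs & forall z, z \in rs -> f z <= f m.
  elim: rs {prs specE} z0 z0rs => // x [|y s] IH z0 _.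
    by exists x; rewrite ?inE// => z; rewrite inE => /eqP ->.
  have [m ms mmax] := IH y (mem_head y s).
  have [fxm|fmx] := leP (f x) (f m).
    exists m; first by rewrite inE ms orbT.
    by move=> z; rewrite inE => /predU1P[-> //|]; exact: mmax.
  exists x; first exact: mem_head.
  move=> z; rewrite inE => /predU1P[-> //|/mmax/le_trans]; apply; exact: ltW.
have ubm : ubound [set f z | z in spectrum A] (f m).
  by move=> _ [z /specE zrs <-]; exact: mmax.
have ub z : spectrum A z -> f z <= rho A.
  by move=> zA; apply: ub_le_sup; [exists (f m) | exists z].
have mA : spectrum A m by exact/specE.
split=> //; exists m => //; apply/eqP; rewrite eq_le; apply/andP; split.
  by apply: ge_sup => //; exists (f m), m.
exact: ub.
Qed.

(* Main.v *)
(* If every eigenvalue of A has modulus at most b0 < b, Cayley-Hamilton and an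
   induction on the list of eigenvalues give an equivalent norm V with
   V (A x) <= b V x.
   For (i), the errors evolve entrywise under 1 - mu1 H. A right eigenvector of
   H for an eigenvalue with nonpositive real part would have an entry of maximal
   modulus whose in-neighbours all attain the maximum as well; following a
   path back to the leader, where the error is 0, is contradictory. So the
   spectrum of H lies in the open right half-plane, and mu1 < 2 / rho H makes
   1 - mu1 H Schur.
   For (ii), the stacked errors satisfy xi(t+1) = M xi(t) + g(t) with M Schur
   and |g(t)| <= d gamma^t (|xi(t)| + 1): the matrix errors decay like alpha^t,
   while v grows at most like b^t, and b > 1 can be chosen with alpha b < 1. In
   the adapted norm of M, a discrete Gronwall argument concludes. *)
Require Import Defs.
From mathcomp Require Import all_boot all_order all_algebra.
From mathcomp Require Import all_classical all_reals all_analysis.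
From mathcomp Require Import ring lra.

Set Implicit Arguments.
Unset Strict Implicit.
Unset Printing Implicit Defensive.

Import Order.TTheory GRing.Theory Num.Theory.
Import numFieldNormedType.Exports.

Local Open Scope complex_scope.
Local Open Scope ring_scope.
Import Normc.

(** * Norms, and norms adapted to a bound on the spectrum *)

Lemma mx_entry_le_norm (R : realType) m n (A : 'M[R]_(m, n)) i j :
  `|A i j| <= `|A|.
Proof.
rewrite -[leRHS]/(mx_norm A) mx_normrE.
by apply: (le_trans _ (le_bigmax _ _ (i, j))).
Qed.

Lemma mx_norm_le (R : realType) m n (A : 'M[R]_(m, n)) c :
  0 <= c -> (forall i j, `|A i j| <= c) -> `|A| <= c.
Proof.
move=> c0 Ac; rewrite -[leLHS]/(mx_norm A) mx_normrE.
by apply: bigmax_le => // -[i j] _ /=.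
Qed.

Lemma mulmx_norm_le (R : realType) m n p (A : 'M[R]_(m, n)) (B : 'M[R]_(n, p)) :
  `|A *m B| <= n%:R * (`|A| * `|B|).
Proof.
apply: mx_norm_le => [|i j]; first by rewrite !mulr_ge0.
rewrite mxE; apply: (le_trans (ler_norm_sum _ _ _)).
rewrite mulr_natl -[X in _ *+ X]card_ord -sumr_const; apply: ler_sum => k _.
by rewrite normrM ler_pM // mx_entry_le_norm.
Qed.

(** Built on [normc] so that its values lie in [R] rather than in [R[i]]. *)
Definition norm1 (R : realType) n (x : 'cV[R[i]]_n) : R :=
  \sum_i normc (x i 0).

Lemma normc_ge0 (R : realType) (z : R[i]) : 0 <= normc z.
Proof. by case: z => a b; rewrite /normc sqrtr_ge0. Qed.

Lemma normc_sum (R : realType) (I : Type) (r : seq I) (P : pred I)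
    (F : I -> R[i]) :
  normc (\sum_(i <- r | P i) F i) <= \sum_(i <- r | P i) normc (F i).
Proof.
elim/big_rec2: _ => [|i y x _ h]; first by rewrite normc0.
by apply: (le_trans (le_normcD _ _)); rewrite lerD2l.
Qed.

Lemma normc_real (R : realType) (x : R) : normc x%:C = `|x|.
Proof. by rewrite /= expr0n addr0 sqrtr_sqr. Qed.

Lemma norm1_ge0 (R : realType) n (x : 'cV[R[i]]_n) : 0 <= norm1 x.
Proof. by apply: sumr_ge0 => i _; exact: normc_ge0. Qed.

Lemma norm1D (R : realType) n (x y : 'cV[R[i]]_n) :
  norm1 (x + y) <= norm1 x + norm1 y.
Proof.
by rewrite -big_split; apply: ler_sum => i _; rewrite mxE; exact: le_normcD.
Qed.

Lemma norm1Z (R : realType) n z (x : 'cV[R[i]]_n) :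
  norm1 (z *: x) = normc z * norm1 x.
Proof. by rewrite mulr_sumr; apply: eq_bigr => i _; rewrite mxE normcM. Qed.

Lemma norm1M (R : realType) n (A : 'M[R[i]]_n) (x : 'cV[R[i]]_n) :
  norm1 (A *m x) <= (\sum_i \sum_j normc (A i j)) * norm1 x.
Proof.
rewrite mulr_suml; apply: ler_sum => i _; rewrite mxE mulr_suml.
apply: (le_trans (normc_sum _ _ _)); apply: ler_sum => j _.
rewrite normcM ler_wpM2l ?normc_ge0//.
by rewrite /norm1 (bigD1 j)//= lerDl sumr_ge0// => k _; exact: normc_ge0.
Qed.

(* For s = z :: s', V x is d |x| + V' ((A - z) x), where V' is obtained from s'
   with a rate b' in ]b0, b[ and the small weight d lets the slack (b - b') V'
   absorb d |(A - z) x|. *)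
Lemma adapted_norm_annihilated (R : realType) n (A : 'M[R[i]]_n.+1)
    (s : seq R[i]) (b0 b : R) :
  {in s, forall z, normc z <= b0} -> b0 < b ->
  exists (V : 'cV[R[i]]_n.+1 -> R) (c K : R),
  [/\ 0 < c, 0 <= K,
      forall x, 0 <= V x <= K * norm1 x,
      forall x y, V (x + y) <= V x + V y
    & forall x, horner_mx A (\prod_(z <- s) ('X - z%:P)) *m x = 0 ->
        c * norm1 x <= V x /\ V (A *m x) <= b * V x].
Proof.
elim: s b => [|z s IH] b sb0 b0b.
  (* The empty product is 1, so only x = 0 is annihilated and the zero functional suffices. *)
  exists (fun=> 0), 1, 0; split=> // [x|x]; first by rewrite mul0r lexx.
  rewrite big_nil rmorph1 mul1mx => ->.
  by rewrite mulr0 /norm1 big1 ?mulr0// => i _; rewrite mxE normc0.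
have zb0 : normc z <= b0 by apply: sb0; exact: mem_head.
have [V [c [K [c0 K0 VK VD VA]]]] := IH ((b0 + b) / 2)
  (fun y ys => sb0 y (mem_behead (s := z :: s) ys)) ltac:(lra).
set b' := (b0 + b) / 2 in VA *.
(* This d gives d |T x| <= (b - b') V (T x), because c |T x| <= V (T x) whenever the factors in s
   annihilate T x. *)
pose T := A - z%:M; pose d := (b - b') * c.
have d0 : 0 < d by apply: mulr_gt0 => //; rewrite /b'; lra.
pose nT := \sum_i \sum_j normc (T i j).
have nT0 : 0 <= nT.
  by apply: sumr_ge0 => i _; apply: sumr_ge0 => j _; exact: normc_ge0.
exists (fun x => d * norm1 x + V (T *m x)), d, (d + K * nT).
split=> // [|x|x y|x].
- by rewrite addr_ge0 ?(ltW d0) ?mulr_ge0.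
- have /andP[V0 V1] := VK (T *m x).
  apply/andP; split; first by rewrite addr_ge0// mulr_ge0 ?norm1_ge0// ltW.
  by rewrite mulrDl lerD2l -mulrA (le_trans V1)// ler_wpM2l// norm1M.
- rewrite mulmxDr; have := VD (T *m x) (T *m y); have := norm1D x y.
  rewrite -(ler_pM2l d0); lra.
(* If the full product annihilates x, the product over s annihilates T x, so the induction
   hypothesis applies to T x. *)
rewrite big_cons mulrC rmorphM /= -mulmxE rmorphB /= horner_mx_X horner_mx_C.
rewrite -/T -mulmxA => /VA[lo hi]; have /andP[V0 _] := VK (T *m x).
split; first lra.
have -> : T *m (A *m x) = A *m (T *m x).
  by rewrite !mulmxA /T mulmxBl mulmxBr mul_scalar_mx mul_mx_scalar.
have Ax : norm1 (A *m x) <= normc z * norm1 x + norm1 (T *m x).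
  rewrite -norm1Z; apply: le_trans (norm1D _ _).
  by rewrite mulmxBl mul_scalar_mx addrC subrK.
have x0 := norm1_ge0 x; have b'b : b' < b by rewrite /b'; lra.
rewrite -(ler_pM2l d0) in Ax.
have h1 : d * (normc z * norm1 x) <= d * (b * norm1 x).
  by rewrite ler_pM2l// ler_wpM2r//; lra.
have h2 : d * norm1 (T *m x) <= (b - b') * V (T *m x).
  by rewrite /d -mulrA ler_wpM2l//; lra.
rewrite mulrDr mulrCA; lra.
Qed.

Lemma char_poly_splits (R : realType) n (A : 'M[R]_n) :
  exists s : seq R[i],
    char_poly (map_mx (real_complex R) A) = \prod_(z <- s) ('X - z%:P) /\
    forall z, spectrum A z <-> z \in s.
Proof.
set p := char_poly _; have mp : p \is monic by exact: char_poly_monic.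
have [s ps] := closed_field_poly_normal p.
rewrite (monicP mp) scale1r in ps; exists s; split=> // z.
by rewrite /spectrum /= eigenvalue_root_char -/p ps root_prod_XsubC.
Qed.

(** The spectrum is finite, so its largest modulus is still below 1; starting the maximum at 0
    covers an empty spectrum. *)
Lemma schur_bound (R : realType) n (A : 'M[R]_n) : schur A ->
  exists b0 : R, [/\ 0 <= b0, b0 < 1 & forall z, spectrum A z -> normc z <= b0].
Proof.
move=> sA; have [s [_ sE]] := char_poly_splits A.
exists (\big[Num.max/0]_(z <- s) normc z); split.
- by rewrite bigmax_ge_id.
- rewrite big_seq; apply: bigmax_lt => // z zs.
  by apply: sA; apply/sE.
- by move=> z /sE zs; apply: le_bigmax_seq.
Qed.

(** By Cayley-Hamilton the product over all eigenvalues annihilates every vector, so the conditional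
    estimates become global. Real vectors are embedded in the complex ones, and dividing by c
    normalises the lower bound. *)
Lemma adapted_norm (R : realType) n (A : 'M[R]_n) (b0 b : R) :
  (forall z, spectrum A z -> normc z <= b0) -> b0 < b ->
  exists (V : 'cV[R]_n -> R) (K : R),
  [/\ 0 <= K, forall x, `|x| <= V x <= K * `|x|,
      forall x y, V (x + y) <= V x + V y & forall x, V (A *m x) <= b * V x].
Proof.
case: n A => [|n] A sA b0b.
  exists (fun=> 0), 0; split=> // [x|x]; last by rewrite mulr0.
  by rewrite mul0r lexx andbT; apply: mx_norm_le => // -[].
have [s [ps sE]] := char_poly_splits A.
have [V [c [K [c0 K0 VK VD VA]]]] := adapted_norm_annihilated
  (map_mx (real_complex R) A) (fun z zs => sA z (proj2 (sE z) zs)) b0b.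
pose f (x : 'cV[R]_n.+1) := map_mx (real_complex R) x.
have {}VA x : c * norm1 (f x) <= V (f x) /\ V (f (A *m x)) <= b * V (f x).
  by rewrite /f map_mxM; apply: VA; rewrite -ps Cayley_Hamilton mul0mx.
have fE x i : normc (f x i 0) = `|x i 0| by rewrite mxE normc_real.
exists (fun x => V (f x) / c), (K * n.+1%:R / c).
split=> [|x|x y|x].
- by rewrite divr_ge0 ?mulr_ge0// ltW.
- rewrite ler_pdivlMr// mulrAC ler_pdivrMr// divfK ?gt_eqF//.
  apply/andP; split.
    apply: (le_trans _ (proj1 (VA x))); rewrite mulrC ler_pM2l//.
    apply: mx_norm_le => [|i j]; first exact: norm1_ge0.
    rewrite ord1 -fE /norm1 (bigD1 i)//= lerDl.
    by apply: sumr_ge0 => k _; exact: normc_ge0.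
  have /andP[_ /le_trans] := VK (f x); apply.
  rewrite -mulrA ler_wpM2l// mulr_natl -[X in _ *+ X]card_ord -sumr_const.
  by apply: ler_sum => i _; rewrite fE mx_entry_le_norm.
- by rewrite -mulrDl ler_pM2r ?invr_gt0// /f map_mxD.
- by rewrite mulrA ler_pM2r ?invr_gt0//; case: (VA x).
Qed.

(** * Growth and decay of perturbed linear recursions *)

Lemma discrete_gronwall (R : realType) (w : nat -> R) (b gamma e : R) :
  0 <= b < 1 -> 0 <= gamma < 1 -> 0 <= e -> (forall t, 0 <= w t) ->
  (forall t, w t.+1 <= b * w t + e * gamma ^+ t * (w t + 1)) ->
  exists c alpha : R,
    [/\ 0 < c, 0 < alpha, alpha < 1 & forall t, w t <= c * alpha ^+ t].
Proof.
move=> /andP[b0 b1] /andP[g0 g1] e0 w0 wS.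
(* The rate is the midpoint of max(b, gamma) and 1; it lies strictly above gamma so that d = gamma /
   alpha < 1. *)
have [al [al0 al1 bal gal]] :
    exists al, [/\ 0 < al, al < 1, b <= al & gamma < al].
  have bM : b <= Num.max b gamma by rewrite le_max lexx.
  have gM : gamma <= Num.max b gamma by rewrite le_max lexx orbT.
  have M1 : Num.max b gamma < 1 by rewrite gt_max b1.
  by exists ((Num.max b gamma + 1) / 2); split; lra.
pose d := gamma / al; have d0 : 0 <= d by rewrite divr_ge0// ltW.
have d1 : d < 1 by rewrite ltr_pdivrMr// mul1r.
pose e' := e / al; have e'0 : 0 <= e' by rewrite divr_ge0// ltW.
(* The added 1 absorbs the inhomogeneous term of the recursion. *)
pose y t := w t / al ^+ t + 1.
have y0 t : 0 <= y t by rewrite addr_ge0// divr_ge0// exprn_ge0// ltW.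
(* After division by alpha^t, the affine recursion becomes a product of factors
   1 + e' d^t <= exp (e' d^t), whose exponents are summable. *)
have yS t : y t.+1 <= (1 + e' * d ^+ t) * y t.
  have at0 : 0 < al ^+ t by exact: exprn_gt0.
  have at1 : al ^+ t <= 1 by rewrite exprn_ile1// ltW.
  rewrite -[y t.+1](@mulKf _ (al ^+ t.+1)) ?expf_neq0 ?gt_eqF//.
  rewrite ler_pdivrMl ?exprn_gt0//.
  have -> : al ^+ t.+1 * y t.+1 = w t.+1 + al ^+ t.+1.
    by rewrite /y mulrDr mulr1 mulrCA divff ?mulr1// expf_neq0// gt_eqF.
  have -> : al ^+ t.+1 * ((1 + e' * d ^+ t) * y t) =
      al * (w t + al ^+ t) + e * gamma ^+ t * (w t / al ^+ t + 1).
    rewrite /y /e' /d expr_div_n exprS; field.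
    by rewrite expf_neq0 gt_eqF.
  have h1 : b * w t <= al * w t by rewrite ler_wpM2r.
  have h2 : e * gamma ^+ t * (w t + 1) <= e * gamma ^+ t * (w t / al ^+ t + 1).
    rewrite ler_wpM2l ?mulr_ge0 ?exprn_ge0// lerD2r ler_pdivlMr//.
    by rewrite ler_piMr.
  have := wS t; rewrite exprS; lra.
(* The exponent is the partial geometric sum of the e' d^k for k < t. *)
have yE t : y t <= y 0%N * expR (e' * (1 - d ^+ t) / (1 - d)).
  elim: t => [|t IH]; first by rewrite expr0 subrr mulr0 mul0r expR0 mulr1.
  have -> : e' * (1 - d ^+ t.+1) / (1 - d) =
      e' * (1 - d ^+ t) / (1 - d) + e' * d ^+ t.
    by rewrite exprS; field; rewrite subr_eq0 gt_eqF.
  rewrite expRD mulrA mulrC; apply: (le_trans (yS t)).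
  apply: ler_pM => //; last exact: expR_ge1Dx.
  by rewrite addr_ge0// mulr_ge0// exprn_ge0.
exists (y 0%N * expR (e' / (1 - d))), al; split=> // [|t].
  rewrite mulr_gt0 ?expR_gt0//; apply: ltr_wpDl => //.
  by rewrite divr_ge0// exprn_ge0// ltW.
rewrite -ler_pdivrMr ?exprn_gt0//; apply: (le_trans (y := y t)).
  by rewrite lerDl.
apply: (le_trans (yE t)); rewrite ler_wpM2l// ler_expR.
rewrite ler_pM2r ?invr_gt0 ?subr_gt0// ler_piMr// gerBl exprn_ge0//.
Qed.

(** Measured in the adapted norm V, the linear part contracts by b < 1. The perturbation costs a
    factor K, and |x| <= V x turns its bound into one in V x, as the Gronwall estimate requires. *)
Lemma perturbed_schur_decay (R : realType) n (A : 'M[R]_n)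
    (x g : nat -> 'cV[R]_n) (d gamma : R) :
  schur A -> 0 <= d -> 0 <= gamma < 1 ->
  (forall t, x t.+1 = A *m x t + g t) ->
  (forall t, `|g t| <= d * gamma ^+ t * (`|x t| + 1)) ->
  exists c alpha : R,
    [/\ 0 < c, 0 < alpha, alpha < 1 & forall t, `|x t| <= c * alpha ^+ t].
Proof.
move=> sA d0 g01 xS gb; have [b0 [b00 b01 sb]] := schur_bound sA.
have [|V [K [K0 VK VD VA]]] := adapted_norm (b := (b0 + 1) / 2) sb; first lra.
have Vx y : `|y| <= V y by case/andP: (VK y).
have V0 y : 0 <= V y by exact: le_trans (Vx y).
have [||||c [al [c0 al0 al1 wb]]] :=
    discrete_gronwall (w := fun t => V (x t)) (b := (b0 + 1) / 2)
      (e := K * d) _ g01.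
- by apply/andP; split; lra.
- exact: mulr_ge0.
- by [].
- move=> t; rewrite xS; apply: (le_trans (VD _ _)); apply: lerD => //.
  have /andP[_ /le_trans] := VK (g t); apply.
  rewrite -!mulrA ler_wpM2l// mulrA; apply: (le_trans (gb t)).
  rewrite ler_wpM2l ?lerD2r// mulr_ge0// exprn_ge0//.
  by case/andP: g01.
by exists c, al; split=> // t; exact: le_trans (wb t).
Qed.

(** V is chosen before the orbit, so a single V serves all the entries of the matrix errors. *)
Lemma linear_orbit_bound (R : realType) n (A : 'M[R]_n) (b0 b : R) :
  (forall z, spectrum A z -> normc z <= b0) -> b0 < b -> 0 <= b ->
  exists V : 'cV[R]_n -> R, (forall x, 0 <= V x) /\
    forall x : nat -> 'cV[R]_n, (forall t, x t.+1 = A *m x t) ->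
      forall t, `|x t| <= V (x 0%N) * b ^+ t.
Proof.
move=> sA b0b b_ge0; have [V [K [K0 VK VD VA]]] := adapted_norm sA b0b.
have Vx y : `|y| <= V y by case/andP: (VK y).
exists V; split=> [y|x xS t]; first exact: le_trans (Vx y).
apply: (le_trans (Vx _)); elim: t => [|t IH]; first by rewrite mulr1.
rewrite xS exprS mulrCA; apply: (le_trans (VA _)).
by rewrite ler_wpM2l.
Qed.

Lemma exp_bound_cvg0 (R : realType) (V : normedModType R) (y : nat -> V)
    (c alpha : R) :
  0 < c -> 0 < alpha -> alpha < 1 -> (forall t, `|y t| <= c * alpha ^+ t) ->
  exp_cvg0 y.
Proof.
move=> c0 a0 a1 yb; split; last by exists c, alpha.
apply/norm_cvg0P.
apply: (@squeeze_cvgr _ _ _ _ (fun=> 0) (fun t => c * alpha ^+ t)).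
- by apply: nearW => t; rewrite normr_ge0 yb.
- exact: cvg_cst.
- by apply: cvg_geometric; rewrite gtr0_norm.
Qed.

(** * The spectrum of H and the Schur property of 1 - mu H *)

(** Since y vanishes at the leader, the missing column 0 of H contributes nothing. Values in an
    arbitrary module cover complex scalars, matrices and vectors alike. *)
Lemma Hmx_sum (R : realType) N (a : 'M[R]_N.+1) (V : lmodType R)
    (y : 'I_N.+1 -> V) (i : 'I_N) :
  (forall k, a k k = 0) -> y ord0 = 0 ->
  \sum_j Hmx a i j *: y (follower j) =
  \sum_k a (follower i) k *: (y (follower i) - y k).
Proof.
move=> a0 y0; under [RHS]eq_bigr do rewrite scalerBr.
rewrite sumrB -scaler_suml big_ord_recl [in X in _ = _ - X]big_ord_recl.
rewrite y0 scaler0 add0r (bigD1 i)//= [in X in _ = _ - X](bigD1 i)//=.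
rewrite a0 scale0r add0r mxE eqxx big_ord_recl -sumrN; congr (_ + _).
by apply: eq_bigr => j ji; rewrite mxE eq_sym (negPf ji) scaleNr.
Qed.

(** [eigenvalue] speaks of row vectors; a singular square matrix also has a nonzero right kernel. *)
Lemma eigenvalue_colvec (F : fieldType) n (A : 'M[F]_n) z :
  eigenvalue A z -> exists2 x : 'cV[F]_n, A *m x = z *: x & x != 0.
Proof.
move=> Az; have : ~~ row_free (A - z%:M)^T.
  rewrite row_free_unit unitmx_tr -row_free_unit -kermx_eq0.
  by move: Az; rewrite /eigenvalue /eigenspace.
rewrite -kermx_eq0 => /rowV0Pn[v /sub_kermxP vA v0].
exists v^T; last by rewrite trmx_eq0.
apply/eqP; rewrite -subr_eq0 -mul_scalar_mx -mulmxBl; apply/eqP.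
by apply: trmx_inj; rewrite trmx_mul trmxK vA trmx0.
Qed.

Lemma Re_le_normc (R : realType) (z : R[i]) : complex.Re z <= normc z.
Proof.
case: z => x y /=; apply: (le_trans (ler_norm _)).
by rewrite -sqrtr_sqr ler_wsqrtr// lerDl sqr_ge0.
Qed.

(** Let d be the sum of the weights into i. Then (d - z) y_i is the weighted sum of the y_k, and Re
    z <= 0 gives |d - z| >= d. Hence the nonnegative terms a_ik (|y_i| - |y_k|) sum to at most 0,
    and each of them vanishes. *)
Lemma maximal_modulus_neighbour (R : realType) n (E : rel 'I_n) (a : 'M[R]_n)
    (y : 'I_n -> R[i]) (z : R[i]) (i : 'I_n) :
  weighted_adjacency E a -> complex.Re z <= 0 ->
  (forall k, normc (y k) <= normc (y i)) ->
  \sum_k (a i k)%:C * (y i - y k) = z * y i ->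
  forall k, E k i -> normc (y k) = normc (y i).
Proof.
move=> [_ apos a0] z0 ymax yz.
have a_ge0 k : 0 <= a i k.
  by case: (boolP (E k i)) => [/apos/ltW|/a0 ->].
pose d := \sum_k a i k.
have dyz : (d%:C - z) * y i = \sum_k (a i k)%:C * y k.
  rewrite mulrBl -yz rmorph_sum mulr_suml -sumrB; apply: eq_bigr => k _ /=.
  by ring.
have dz : d <= normc (d%:C - z).
  apply: (le_trans _ (Re_le_normc _)); case: z z0 {yz dyz} => p r /= p0; lra.
have s0 : \sum_k a i k * (normc (y i) - normc (y k)) <= 0.
  under eq_bigr do rewrite mulrBr.
  rewrite sumrB -mulr_suml -/d subr_le0.
  apply: (@le_trans _ _ (normc ((d%:C - z) * y i))).
    by rewrite normcM ler_wpM2r// normc_ge0.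
  rewrite dyz; apply: (le_trans (normc_sum _ _ _)); apply: ler_sum => k _.
  by rewrite normcM normc_real ger0_norm.
have t0 k : true -> 0 <= a i k * (normc (y i) - normc (y k)).
  by move=> _; rewrite mulr_ge0// subr_ge0.
have /(psumr_eq0P t0) h : \sum_k a i k * (normc (y i) - normc (y k)) = 0.
  by apply/eqP; rewrite eq_le s0 sumr_ge0.
move=> k /apos aik; apply/esym/eqP; rewrite -subr_eq0.
by have /eqP := h k isT; rewrite mulf_eq0 gt_eqF.
Qed.

(** [Rcomplex] views the complex numbers as a real module, to which [Hmx_sum] applies. *)
Lemma scale_Rcomplex (R : realType) (x : R) (z : R[i]) :
  x *: (z : Rcomplex R) = x%:C * z.
Proof.
case: z => p r; apply/eqP.
by rewrite eq_complex /= !mul0r subr0 addr0 !eqxx.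
Qed.

Lemma Hmx_spectrum_Re_gt0 (R : realType) N (E : rel 'I_N.+1)
    (a : 'M[R]_N.+1) (z : R[i]) :
  weighted_adjacency E a -> spanning_tree_rooted_at E ord0 ->
  spectrum (Hmx a) z -> 0 < complex.Re z.
Proof.
move=> Ha tree /eigenvalue_colvec[x Hx x0]; rewrite ltNge; apply/negP => z0.
have [a0 _ _] := Ha.
(* The eigenvector is extended by 0 at the leader. *)
pose y (k : 'I_N.+1) : R[i] := oapp (fun i => x i 0) 0 (unlift ord0 k).
have y0 : y ord0 = 0 by rewrite /y unlift_none.
have yx i : y (follower i) = x i 0 by rewrite /y liftK.
have yz i : \sum_k (a (follower i) k)%:C * (y (follower i) - y k) =
    z * y (follower i).
  have /matrixP/(_ i 0) := Hx; rewrite mxE [RHS]mxE -yx => <-.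
  transitivity (\sum_k a (follower i) k *: (y (follower i) - y k : Rcomplex R)).
    by apply: eq_bigr => k _; rewrite scale_Rcomplex.
  rewrite -(@Hmx_sum _ _ _ (Rcomplex R) y)//.
  by apply: eq_bigr => j _; rewrite scale_Rcomplex [in RHS]mxE -yx.
have [m _ ymax] := @arg_maxP _ _ _ ord0 xpredT (fun k => normc (y k)) isT.
have {}ymax k : normc (y k) <= normc (y m) by exact: ymax.
have M0 : 0 < normc (y m).
  have /cV0Pn[i xi0] := x0; apply: lt_le_trans (ymax (follower i)).
  rewrite lt_def normc_ge0 andbT yx; apply: contra xi0 => /eqP/eq0_normc ->.
  by [].
have step k i : E k i -> normc (y i) = normc (y m) ->
    normc (y k) = normc (y m).
  move=> Eki yi; rewrite -yi.
  (* Only followers satisfy the eigenvector equation; the leader is excluded because its value 0 is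
     below the positive maximum. *)
  case: (unliftP ord0 i) => [j ij|i0]; last first.
    by rewrite i0 y0 normc0 in yi; rewrite -yi ltxx in M0.
  have := yz j; rewrite /follower -ij => yzi.
  by apply: maximal_modulus_neighbour yzi _ Eki => // l; rewrite yi.
have /connectP[p Ep mp] : connect E ord0 m.
  by case: (eqVneq m ord0) => [->|/tree//]; exact: connect0.
suff : normc (y ord0) = normc (y m).
  by rewrite y0 normc0 => h; rewrite -h ltxx in M0.
(* Induction on a path to m, with its origin generalised, carries the maximal modulus back to the
   leader. *)
move: mp Ep; elim: p (ord0 : 'I_N.+1) => [|k p IH] j /=; first by move=> ->.
by move=> mp /andP[Ejk Ep]; exact: step (IH _ mp Ep).
Qed.

(** An eigenvalue z of 1 - mu H is 1 - mu l with l an eigenvalue of H, and |z|^2 = 1 - 2 mu Re l +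
    mu^2 |l|^2. This is below 1 because mu |l|^2 <= mu rho(H) Re l < 2 Re l. *)
Lemma schur_1_sub_Hmx (R : realType) N (E : rel 'I_N.+1) (a : 'M[R]_N.+1)
    (mu : R) :
  weighted_adjacency E a -> spanning_tree_rooted_at E ord0 ->
  0 < mu < 2 / rho (Hmx a) -> schur (1%:M - mu *: Hmx a).
Proof.
move=> Ha tree /andP[mu0 mu_lt] z /eigenvalueP[u uz u0].
have muC0 : mu%:C != 0 :> R[i] by rewrite eq_complex /= eqxx andbT gt_eqF.
pose l := (1 - z) / mu%:C.
have Hl : spectrum (Hmx a) l.
  apply/eigenvalueP; exists u => //; move: uz.
  rewrite map_mxB map_mx1 map_mxZ mulmxBr mulmx1 -scalemxAr => uz.
  rewrite /l mulrC -scalerA scalerBl scale1r -uz opprB addrC subrK.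
  by rewrite scalerA mulVf// scale1r.
(* A nonzero eigenvector rules out N = 0, where [rho_max] does not apply. *)
have N0 : (0 < N)%N.
  by case: (N) u u0 {uz Hl} => // u; rewrite [u]thinmx0 eqxx.
have := Hmx_spectrum_Re_gt0 Ha tree Hl.
have := proj2 (rho_max (Hmx a) N0) _ Hl.
have -> : z = 1 - mu%:C * l by rewrite /l mulrC divfK// opprB addrC subrK.
have rho0 : 0 < rho (Hmx a).
  have := lt_trans mu0 mu_lt.
  by rewrite pmulr_rgt0// invr_gt0.
move: mu_lt; rewrite ltr_pdivlMr//; move: (rho _) rho0 => r r0 mur.
case: l {Hl} => p s /= hr p0; move: hr; rewrite ler_pdivrMr//.
rewrite sqr_sqrtr ?addr_ge0 ?sqr_ge0// => hr.
rewrite !mul0r subr0 addr0 sub0r.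
rewrite -[ltRHS]sqrtr1 ltr_sqrt//.
have h1 : mu * (p ^+ 2 + s ^+ 2) < 2 * p.
  apply: (le_lt_trans (y := mu * (r * p))); first by rewrite ler_pM2l.
  by rewrite mulrA ltr_pM2r.
have h2 : mu * (mu * (p ^+ 2 + s ^+ 2)) < mu * (2 * p) by rewrite ltr_pM2l.
rewrite !expr2 in h2 *; lra.
Qed.

(** * Kronecker products acting on stacked vectors *)

Definition stack (R : realType) N q (x : 'I_N -> 'cV[R]_q) : 'cV[R]_(N * q) :=
  \col_m x (mxtens_unindex m).1 (mxtens_unindex m).2 0.

Lemma stackE (R : realType) N q (x : 'I_N -> 'cV[R]_q) i k :
  stack x (mxtens_index (i, k)) 0 = x i k 0.
Proof. by rewrite mxE mxtens_indexK. Qed.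

(** This is the identity (A ⊗ B) vec X = vec (B X A^T), where the x j are the columns of X. *)
Lemma tensmx_stack (R : realType) N q (A : 'M[R]_N) (B : 'M[R]_q)
    (x : 'I_N -> 'cV[R]_q) :
  (A *t B) *m stack x = stack (fun i => B *m \sum_j A i j *: x j).
Proof.
apply/matrixP => m o; rewrite ord1; case: (mxtens_indexP m) => i k.
rewrite stackE !mxE (reindex_onto (@mxtens_index _ _)
  (@mxtens_unindex _ _)); last first.
  by move=> l _; rewrite mxtens_unindexK.
rewrite (eq_bigl xpredT) => [|l]; last by rewrite mxtens_indexK eqxx.
under [RHS]eq_bigr do rewrite summxE mulr_sumr.
rewrite exchange_big pair_bigA; apply: eq_bigr => -[j l] _.
by rewrite tensmxE stackE mxE mulrCA mulrA.
Qed.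

Lemma stack_norm_ge (R : realType) N q (x : 'I_N -> 'cV[R]_q) i :
  `|x i| <= `|stack x|.
Proof.
apply: mx_norm_le => // k o; rewrite ord1 -stackE.
exact: mx_entry_le_norm.
Qed.

Lemma stack_norm_le (R : realType) N q (x : 'I_N -> 'cV[R]_q) c :
  0 <= c -> (forall i, `|x i| <= c) -> `|stack x| <= c.
Proof.
move=> c0 xc; apply: mx_norm_le => // m o; rewrite ord1 mxE.
exact: le_trans (mx_entry_le_norm _ _ _) (xc _).
Qed.

(** * Error dynamics of the observers *)

Lemma observer_matrix_error_bound (R : realType) (N q : nat)
    (E : rel 'I_N.+1) (a : 'M[R]_N.+1) (mu : R) (S : 'M[R]_q)
    (Sn : 'I_N.+1 -> nat -> 'M[R]_q) :
  weighted_adjacency E a -> (forall t, Sn ord0 t = S) ->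
  (forall (i : 'I_N) t,
     Sn (follower i) t.+1 =
       Sn (follower i) t +
       mu *: \sum_j a (follower i) j *: (Sn j t - Sn (follower i) t)) ->
  spanning_tree_rooted_at E ord0 -> 0 < mu < 2 / rho (Hmx a) ->
  exists c alpha : R, [/\ 0 < c, 0 < alpha, alpha < 1 &
    forall i t, `|Sn (follower i) t - S| <= c * alpha ^+ t].
Proof.
move=> Ha HS0 HSn tree mu_lt; have [a0 _ _] := Ha.
have [b0 [b00 b01 sb]] := schur_bound (schur_1_sub_Hmx Ha tree mu_lt).
have [||V [V0 Vb]] := linear_orbit_bound (b := (b0 + 1) / 2) sb; try lra.
(* For fixed (k, l), the (k, l) entries of the followers' errors form one vector, which evolves
   under 1 - mu H. *)
pose x k l t : 'cV[R]_N := \col_i (Sn (follower i) t - S) k l.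
have xS k l t : x k l t.+1 = (1%:M - mu *: Hmx a) *m x k l t.
  apply/matrixP => i o; rewrite ord1 mulmxBl mul1mx -scalemxAl.
  rewrite [LHS]mxE HSn addrAC.
  pose y j := Sn j t - S.
  have -> : \sum_j a (follower i) j *: (Sn j t - Sn (follower i) t) =
      - \sum_j Hmx a i j *: y (follower j).
    rewrite (Hmx_sum _ (y := y))// /y ?HS0 ?subrr// -sumrN.
    apply: eq_bigr => j _; rewrite -scalerN; congr (_ *: _).
    by rewrite !opprB addrA subrK.
  rewrite scalerN !mxE summxE; congr (_ - _ * _).
  by apply: eq_bigr => j _; rewrite !mxE.
(* The sum dominates the constant of every entry; the 1 keeps it positive when all initial errors
   vanish. *)
exists (1 + \sum_k \sum_l V (x k l 0%N)), ((b0 + 1) / 2); split; try lra.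
  rewrite ltr_wpDr//; apply: sumr_ge0 => k _; exact: sumr_ge0.
move=> i t; have bt0 : 0 <= ((b0 + 1) / 2) ^+ t by apply: exprn_ge0; lra.
have s0 k : 0 <= \sum_l V (x k l 0%N) by exact: sumr_ge0.
have c0 : 0 <= \sum_k \sum_l V (x k l 0%N) by exact: sumr_ge0.
apply: mx_norm_le => [|k l]; first by rewrite mulr_ge0// addr_ge0.
apply: (@le_trans _ _ `|x k l t|).
  by have := mx_entry_le_norm (x k l t) i 0; rewrite mxE.
apply: (le_trans (Vb _ (xS k l) t)); rewrite ler_wpM2r//.
apply: ler_wpDl => //; rewrite (bigD1 k)//= (bigD1 l)//= -addrA lerDl.
by rewrite addr_ge0// sumr_ge0.
Qed.

(** The right-hand side is the update of the eta errors with each S_i replaced by S. *)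
Lemma tensor_error_dynamics (R : realType) N q (H : 'M[R]_N) (S : 'M[R]_q)
    (mu : R) (x : 'I_N -> 'cV[R]_q) :
  (1%:M *t S - mu *: (H *t S)) *m stack x =
  stack (fun i => S *m (x i - mu *: \sum_j H i j *: x j)).
Proof.
rewrite mulmxBl -scalemxAl !tensmx_stack; apply/matrixP => m o.
rewrite ord1; case: (mxtens_indexP m) => i k.
rewrite [LHS]mxE [X in _ + X]mxE [in X in _ + X]mxE !stackE mulmxBr -scalemxAr.
rewrite [RHS]mxE [X in _ = _ + X]mxE [in X in _ = _ + X]mxE; congr (_ - _).
have dE j : (1%:M : 'M[R]_N) i j = (i == j)%:R by rewrite mxE.
rewrite (bigD1 i)//= dE eqxx scale1r big1 ?addr0// => j ji.
by rewrite dE eq_sym (negPf ji) scale0r.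
Qed.

Theorem lemma2 (R : realType) (N q : nat)
  (E : rel 'I_N.+1) (a : 'M[R]_N.+1) (Ha : weighted_adjacency E a)
  (mu1 mu2 : R) (Hmu1 : 0 < mu1) (Hmu2 : 0 < mu2)
  (S : 'M[R]_q) (v : nat -> 'cV[R]_q)
  (Sn : 'I_N.+1 -> nat -> 'M[R]_q) (eta : 'I_N.+1 -> nat -> 'cV[R]_q)
  (Hv : forall t, v t.+1 = S *m v t)
  (HS0 : forall t, Sn ord0 t = S)
  (Heta0 : forall t, eta ord0 t = v t)
  (HSn : forall (i : 'I_N) t,
     Sn (follower i) t.+1 =
       Sn (follower i) t +
       mu1 *: \sum_(j < N.+1)
                a (follower i) j *: (Sn j t - Sn (follower i) t))
  (Heta : forall (i : 'I_N) t,
     eta (follower i) t.+1 =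
       Sn (follower i) t *m eta (follower i) t +
       mu2 *: (Sn (follower i) t *m
               \sum_(j < N.+1)
                 a (follower i) j *: (eta j t - eta (follower i) t))) :
  (spanning_tree_rooted_at E ord0 ->
   0 < mu1 < 2 / rho (Hmx a) ->
   forall i : 'I_N, exp_cvg0 (fun t => Sn (follower i) t - S))
  /\
  ((forall z, spectrum S z -> Normc.normc z <= 1) ->
   spanning_tree_rooted_at E ord0 ->
   0 < mu1 < 2 / rho (Hmx a) ->
   schur ((1%:M : 'M[R]_N) *t S - mu2 *: (Hmx a *t S)) ->
   forall i : 'I_N, exp_cvg0 (fun t => eta (follower i) t - v t)).
Proof.
have SnE := observer_matrix_error_bound Ha HS0 HSn.
split=> [tree mu1_lt i|specS tree mu1_lt sM i].
  have [c [al [c0 al0 al1 Sb]]] := SnE tree mu1_lt.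
  exact: exp_bound_cvg0 c0 al0 al1 (Sb i).
have [c [al [c0 al0 al1 Sb]]] := SnE tree mu1_lt.
have [a0 _ _] := Ha.
(* The midpoint of 1 and 1 / alpha: b > 1 bounds the growth of v, while alpha b = (alpha + 1) / 2 <
   1. *)
pose b := (1 + al^-1) / 2.
have b1 : 1 < b by have := invf_gt1 al0; rewrite al1 /b => ?; lra.
have [|V [V0 Vb]] := linear_orbit_bound specS b1; first lra.
have {Vb} vb := Vb _ Hv; set C := V _ in vb.
pose gamma := al * b.
have gE : gamma = (al + 1) / 2 by rewrite /gamma /b; field; rewrite gt_eqF.
have g01 : 0 <= gamma < 1 by apply/andP; rewrite gE; split; lra.
pose x t i := eta (follower i) t - v t.
pose h := \sum_i \sum_j `|Hmx a i j|.
pose Hx t i := \sum_j Hmx a i j *: x t j.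
(* The update applies S_i to eta_i - mu2 Hx_i, where eta_i = x_i + v. Splitting S_i as S plus its
   error leaves g as the remainder. *)
pose g t i := (Sn (follower i) t - S) *m (x t i + v t - mu2 *: Hx t i).
have xS t : stack (x t.+1) =
    (1%:M *t S - mu2 *: (Hmx a *t S)) *m stack (x t) + stack (g t).
  rewrite tensor_error_dynamics; apply/matrixP => m o; rewrite ord1.
  case: (mxtens_indexP m) => k l; rewrite [RHS]mxE !stackE -/(Hx t k).
  suff -> : x t.+1 k = S *m (x t k - mu2 *: Hx t k) + g t k by rewrite [LHS]mxE.
  have sumE : \sum_j a (follower k) j *: (eta j t - eta (follower k) t) =
      - Hx t k.
    rewrite /Hx (Hmx_sum _ (y := fun j => eta j t - v t))//; last first.
      by rewrite Heta0 subrr.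
    rewrite -sumrN; apply: eq_bigr => j _.
    by rewrite -scalerN; congr (_ *: _); rewrite !opprB addrA subrK.
  (* In terms of w, both sides reduce to S_i w - S v. *)
  rewrite /g; set w := x t k + v t - _.
  have -> : x t k - mu2 *: Hx t k = w - v t by rewrite /w [RHS]addrAC addrK.
  rewrite mulmxBr mulmxBl [RHS]addrC addrA subrK /x Heta Hv sumE.
  by rewrite /w /x subrK mulmxBr mulmxN scalerN -scalemxAr.
have Hxb t k : `|Hx t k| <= h * `|stack (x t)|.
  apply: (le_trans (ler_norm_sum _ _ _)).
  apply: (@le_trans _ _ ((\sum_j `|Hmx a k j|) * `|stack (x t)|)).
    rewrite mulr_suml; apply: ler_sum => j _.
    by rewrite normrZ ler_wpM2l// stack_norm_ge.
  rewrite ler_wpM2r// [leRHS](bigD1 k)//= lerDl.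
  by apply: sumr_ge0 => l _; apply: sumr_ge0.
have h0 : 0 <= h by apply: sumr_ge0 => k _; exact: sumr_ge0.
have C0 : 0 <= C by exact: V0.
(* The factor q comes from the norm of a product, c from the matrix error, and 1, C, mu2 h from x, v
   and Hx respectively. *)
pose d := q%:R * c * (1 + C + mu2 * h).
have d0 : 0 <= d.
  by rewrite /d mulr_ge0 ?addr_ge0 ?mulr_ge0// ltW.
have gb t : `|stack (g t)| <= d * gamma ^+ t * (`|stack (x t)| + 1).
  have [g0 _] := andP g01.
  have gt0 : 0 <= gamma ^+ t by exact: exprn_ge0.
  have at0 : 0 <= al ^+ t by rewrite exprn_ge0// ltW.
  apply: stack_norm_le => [|k].
    by rewrite mulr_ge0 ?addr_ge0// mulr_ge0.
  apply: (le_trans (mulmx_norm_le _ _)).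
  have X0 : 0 <= `|stack (x t)| by [].
  have bt1 : 1 <= b ^+ t by rewrite exprn_ege1// ltW.
  (* Since b^t >= 1, the terms without b^t are absorbed, leaving a single factor b^t to combine with
     alpha^t into gamma^t. *)
  have yb : `|x t k + v t - mu2 *: Hx t k| <=
      (1 + C + mu2 * h) * (`|stack (x t)| + 1) * b ^+ t.
    have h1 : `|x t k + v t - mu2 *: Hx t k| <=
        `|stack (x t)| + C * b ^+ t + mu2 * (h * `|stack (x t)|).
      apply: (le_trans (ler_normB _ _)); apply: lerD.
        apply: (le_trans (ler_normD _ _)); apply: lerD => //.
        exact: stack_norm_ge.
      by rewrite normrZ gtr0_norm// ler_pM2l.
    apply: (le_trans h1).
    have mh0 : 0 <= mu2 * h by rewrite mulr_ge0// ltW.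
    rewrite mulrA; move: (`|stack (x t)|) (b ^+ t) (mu2 * h) X0 bt1 mh0.
    move=> X B m X0 B1 m0; have B0 : 0 <= B by lra.
    have XB : X <= X * B by rewrite ler_peMr.
    have mXB : m * X <= m * (X * B) by rewrite ler_wpM2l.
    have CXB : 0 <= C * (X * B) by rewrite !mulr_ge0.
    have mB : 0 <= m * B by rewrite mulr_ge0.
    lra.
  rewrite /gamma exprMn; set Y := `|stack (x t)| + 1 in yb *.
  have -> : d * (al ^+ t * b ^+ t) * Y =
      q%:R * ((c * al ^+ t) * ((1 + C + mu2 * h) * Y * b ^+ t)).
    by rewrite /d; ring.
  by rewrite ler_wpM2l// ler_pM.
have [c' [al' [c'0 al'0 al'1 xb]]] :=
  perturbed_schur_decay sM d0 g01 xS gb.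
apply: (exp_bound_cvg0 c'0 al'0 al'1) => t.
exact: le_trans (stack_norm_ge (x t) i) (xb t).
Qed.
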